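(* Let $k \geq 1$ be a fixed integer and let $F$ be either the chair or the cricket. There exists a polynomial time algorithm that, given a $(P_5,F)$-free graph $G$, decides whether $G$ is $(k-1)$-colourable, and that, in case $G$ is not $(k-1)$-colourable, also presents a negative certificate of constant size (i.e., of size bounded by a constant depending only on $k$).
   Context: All graphs are finite and simple. For graphs $G, F_1, F_2$, $G$ is $(F_1,F_2)$-free if neither $F_1$ nor $F_2$ is (isomorphic to) an induced subgraph of $G$. $P_5$ is the path on $5$ vertices. The chair is the $5$-vertex graph obtained from a path on $4$ vertices by adding a pendant vertex adjacent to one of the two central vertices of the path. The cricket is the $5$-vertex graph obtained from a triangle by adding two pendant vertices (nonadjacent to each other), both adjacent to the same vertex of the triangle. A graph is $m$-colourable if its vertices can be labelled with labels from $\{1,\ldots,m\}$ so that adjacent vertices receive different labels. A graph $H$ is $k$-vertex-critical if its chromatic number is $k$ but $H-v$ has chromatic number less than $k$ for every $v \in V(H)$. A negative certificate is an induced subgraph of $G$ that is $k$-vertex-critical, which witnesses that $G$ is not $(k-1)$-colourable. Running time is polynomial in the number of vertices of $G$, with $k$ fixed. *)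

(* Defs.v *)
From mathcomp Require Import all_boot.

Set Implicit Arguments.
Unset Strict Implicit.
Unset Printing Implicit Defensive.

(** * Finite simple graphs *)

Record sgraph := SGraph {
  vertex :> finType;
  edge : rel vertex;
  edge_sym : symmetric edge;
  edge_irrefl : irreflexive edge }.

Arguments edge {s} x y.

Section Induced.
Variables (G : sgraph) (S : {set G}).

Definition induced_edge : rel {x : G | x \in S} :=
  fun x y => edge (val x) (val y).

Fact induced_sym : symmetric induced_edge.
Proof. by move=> x y; exact: edge_sym. Qed.

Fact induced_irrefl : irreflexive induced_edge.
Proof. by move=> x; exact: edge_irrefl. Qed.

Definition induced : sgraph := SGraph induced_sym induced_irrefl.
End Induced.

Definition isomorphic (G H : sgraph) : Prop :=
  exists2 f : G -> H, bijective f & forall x y, edge (f x) (f y) = edge x y.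

Definition has_induced (F G : sgraph) : Prop :=
  exists S : {set G}, isomorphic F (induced S).

Definition free2 (F1 F2 G : sgraph) : Prop :=
  ~ has_induced F1 G /\ ~ has_induced F2 G.

Section EdgeList.
Variables (n : nat) (E : seq (nat * nat)).

Definition list_edge : rel 'I_n := fun x y =>
  (x != y) && (((x : nat, y : nat) \in E) || ((y : nat, x : nat) \in E)).

Fact list_edge_sym : symmetric list_edge.
Proof. by move=> x y; rewrite /list_edge eq_sym orbC. Qed.

Fact list_edge_irrefl : irreflexive list_edge.
Proof. by move=> x; rewrite /list_edge eqxx. Qed.

Definition graph_of_edges : sgraph := SGraph list_edge_sym list_edge_irrefl.
End EdgeList.

Definition P5 : sgraph := graph_of_edges 5 [:: (0, 1); (1, 2); (2, 3); (3, 4)].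

Definition chair : sgraph :=
  graph_of_edges 5 [:: (0, 1); (1, 2); (2, 3); (1, 4)].

Definition cricket : sgraph :=
  graph_of_edges 5 [:: (0, 1); (0, 2); (1, 2); (0, 3); (0, 4)].

(** * Colourings *)

Definition colourable (m : nat) (G : sgraph) : bool :=
  [exists f : {ffun G -> 'I_m}, [forall x, forall y, edge x y ==> (f x != f y)]].

Fact colourable_card (G : sgraph) : exists m, colourable m G.
Proof.
exists #|G|; apply/existsP; exists [ffun x => enum_rank x].
apply/'forall_forallP => x y; rewrite !ffunE; apply/implyP => exy.
by apply: contraTneq exy => /enum_rank_inj ->; rewrite edge_irrefl.
Qed.

Definition chromatic_number (G : sgraph) : nat := ex_minn (colourable_card G).

Definition vertex_critical (k : nat) (H : sgraph) : Prop :=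
  chromatic_number H = k /\
  forall v : H, chromatic_number (induced [set~ v]) < k.

(** * Random access machines

    The arithmetic and addressing instructions are those of the Cook-Reckhow
    RAM, with structured control in place of jumps and with directly addressed
    registers kept apart from the indirectly addressed memory.  There is no
    multiplication, so numbers gain at most one bit per step and polynomially
    many unit-cost steps amount to polynomial time on a Turing machine. *)

Inductive instr : Type :=
| Const (x a : nat)                  (* R[x] := a *)
| Add (x y z : nat)                  (* R[x] := R[y] + R[z] *)
| Monus (x y z : nat)                (* R[x] := R[y] - R[z], truncated at 0 *)
| Fetch (x y : nat)                  (* R[x] := M[R[y]] *)
| Store (x y : nat)                  (* M[R[x]] := R[y] *)
| If (x : nat) (p q : seq instr)     (* if R[x] <> 0 then p else q *)
| While (x : nat) (p : seq instr).   (* while R[x] <> 0 do p *)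

Definition program := seq instr.

Record state := State { reg : nat -> nat; memory : nat -> nat }.

Definition upd (f : nat -> nat) (a v : nat) : nat -> nat :=
  fun b => if b == a then v else f b.

Definition set_reg (s : state) (x v : nat) : state :=
  State (upd (reg s) x v) (memory s).

Definition set_mem (s : state) (a v : nat) : state :=
  State (reg s) (upd (memory s) a v).

(* The program component is what remains to be executed; the machine has
   halted when it is empty.  Each test of an [If] or a [While] is one step. *)
Definition step (cs : program * state) : program * state :=
  let: (c, s) := cs in
  match c with
  | [::] => ([::], s)
  | i :: c' =>
    match i with
    | Const x a => (c', set_reg s x a)
    | Add x y z => (c', set_reg s x (reg s y + reg s z))
    | Monus x y z => (c', set_reg s x (reg s y - reg s z))
    | Fetch x y => (c', set_reg s x (memory s (reg s y)))
    | Store x y => (c', set_mem s (reg s x) (reg s y))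
    | If x p q => ((if reg s x != 0 then p else q) ++ c', s)
    | While x p => (if reg s x != 0 then p ++ c else c', s)
    end
  end.

Definition halts_within (t : nat) (p : program) (s s' : state) : Prop :=
  iter t step (p, s) = ([::], s').

(** * Graphs as inputs, vertex sets as outputs

    Vertices are numbered by their position in [enum G]. *)

(* Row-major adjacency matrix. *)
Definition adjacency (G : sgraph) : seq nat :=
  [seq nat_of_bool (edge x y) | x <- enum G, y <- enum G].

(* Initially R[0] is the number of vertices, the memory contains the adjacency
   matrix from address 0 on, and everything else is 0. *)
Definition input (G : sgraph) : state :=
  State (fun x => if x == 0 then #|G| else 0) (nth 0 (adjacency G)).

(* The answer is R[0]: 1 for yes, 0 for no. *)
Definition answers (s : state) (b : bool) : Prop := reg s 0 = nat_of_bool b.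

(* A vertex set is output, in any order and without repetition, as
   M[0], ..., M[R[1] - 1]. *)
Definition outputs (G : sgraph) (s : state) (S : {set G}) : Prop :=
  perm_eq (mkseq (memory s) (reg s 1)) [seq index x (enum G) | x <- enum S].

(* Main.v *)
Require Import Defs.
From mathcomp Require Import all_boot zify.

Set Implicit Arguments.
Unset Strict Implicit.
Unset Printing Implicit Defensive.

(** A [k]-vertex-critical (P5, F)-free graph has boundedly many vertices, so it
    suffices to search all tuples of bounded length for a critical subgraph.

    A critical graph is connected, hence, being P5-free, has radius at most 3,
    and its neighbourhoods are (k-1)-colourable; so it suffices to bound an
    independent set [I] of neighbours of a vertex [v].

    Chair: two nonadjacent vertices with a common neighbour in [I] have nested
    traces on [I] that differ by at most one vertex.  As cliques are bounded,
    deleting boundedly many vertices from [I] leaves a set [J] such that no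
    vertex misses exactly one vertex of [J].  Let [B] be the vertices complete
    to [J].  The vertices outside [B] that are complete to [B] form a proper
    module containing [J]; it is itself critical for fewer colours, hence of
    bounded size by induction.

    Cricket: up to boundedly many exceptions, the vertices of [I] are separated
    by vertices not adjacent to [v].  Two of these with incomparable traces on
    [I] are adjacent, and then their traces, if not disjoint, differ by at most
    one vertex on each side.  So a minimal trace containing a given vertex has
    at most [k] elements, and there are at most [k-1] traces of each size. *)

(** * Colourings of vertex sets *)

Lemma card_bigcup_leq (T I : finType) (r : seq I) (P : pred I) (F : I -> {set T}) :
  #|\bigcup_(i <- r | P i) F i| <= \sum_(i <- r | P i) #|F i|.
Proof.
elim/big_rec2: _ => [|i n A _ le_n]; first by rewrite cards0.
by rewrite (leq_trans (leq_card_setU _ _).1) // leq_add2l.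
Qed.

Section Colouring.
Variables (T : finType) (e : rel T).
Implicit Types (m : nat) (S : {set T}).

Definition proper_on m S (f : T -> nat) : bool :=
  [forall x in S, (f x < m) && [forall y in S, e x y ==> (f x != f y)]].

(** The codomain ['I_m.+1] is inhabited even for [m = 0], which leaves a value for the vertices
    outside [S]; the bound [f x < m] is imposed on [S] only. *)
Definition col m S : bool :=
  [exists f : {ffun T -> 'I_m.+1}, proper_on m S (fun x => f x)].

(* The induced subgraph on [S] is [m.+1]-vertex-critical. *)
Definition crit m S : bool := ~~ col m S && [forall x in S, col m (S :\ x)].

Lemma proper_onP m S f :
  reflect ({in S, forall x, f x < m} /\ {in S &, forall x y, e x y -> f x != f y})
          (proper_on m S f).
Proof.
apply: (iffP forall_inP) => [h|[h1 h2] x xS].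
  split=> [x xS|x y xS yS exy]; first by case/andP: (h _ xS).
  by case/andP: (h _ xS) => _ /forall_inP /(_ _ yS) /implyP; apply.
by rewrite h1 //=; apply/forall_inP=> y yS; apply/implyP; exact: h2.
Qed.

Lemma colP m S : reflect (exists f, proper_on m S f) (col m S).
Proof.
apply: (iffP existsP) => [[f h]|[f /proper_onP[h1 h2]]]; first by eexists; exact: h.
exists [ffun x => inord (f x)]; apply/proper_onP.
have E x : x \in S -> [ffun x => inord (f x) : 'I_m.+1] x = f x :> nat.
  by move=> /h1 fx; rewrite ffunE inordK // ltnW.
by split=> [x xS|x y xS yS exy]; rewrite !E //; [exact: h1 | exact: h2].
Qed.

Lemma sub_col m S S' : S \subset S' -> col m S' -> col m S.
Proof.
move=> /subsetP sSS /colP[f /proper_onP[h1 h2]]; apply/colP; exists f.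
apply/proper_onP; split=> [x /sSS|x y /sSS xS /sSS]; [exact: h1 | exact: h2].
Qed.

Lemma leq_col m m' S : m <= m' -> col m S -> col m' S.
Proof.
move=> le_mm /colP[f /proper_onP[h1 h2]]; apply/colP; exists f.
by apply/proper_onP; split=> // x xS; exact: leq_trans (h1 _ xS) le_mm.
Qed.

Lemma crit_exists m S : ~~ col m S -> exists2 S' : {set T}, S' \subset S & crit m S'.
Proof.
move=> h; have [S' /minsetP[nS' minS'] sS'S] := @minset_exists _ (fun A => ~~ col m A) S h.
exists S' => //; rewrite /crit nS'; apply/forall_inP => x xS'.
apply: contraT => /(minS' (S' :\ x)) /(_ (subsetDl _ _)) /setP /(_ x).
by rewrite !inE eqxx xS'.
Qed.

(** The [m] colour classes are independent. *)
Lemma card_col_leq m c S :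
  col m S ->
  (forall I : {set T}, I \subset S -> {in I &, forall x y, ~~ e x y} -> #|I| <= c) ->
  #|S| <= m * c.
Proof.
move=> /colP[f /proper_onP[h1 h2]] hc.
have sS : S \subset \bigcup_(i < m) [set x in S | f x == i].
  apply/subsetP => x xS; apply/bigcupP; exists (Ordinal (h1 _ xS)) => //.
  by rewrite inE xS /=.
apply: leq_trans (subset_leq_card sS) _.
apply: leq_trans (card_bigcup_leq _ _ _) _.
rewrite -[m in m * c]card_ord -sum_nat_const; apply: leq_sum => i _.
apply: hc; first by apply/subsetP => x; rewrite inE => /andP[].
move=> x y; rewrite !inE => /andP[xS /eqP fx] /andP[yS /eqP fy].
by apply/negP => exy; move: (h2 _ _ xS yS exy); rewrite fx fy eqxx.
Qed.

End Colouring.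

(** * Critical sets *)

Section Critical.
Variables (T : finType) (e : rel T).
Hypotheses (esym : symmetric e) (eirr : irreflexive e).
Implicit Types (m : nat) (S : {set T}).

Lemma crit_del m S x : crit e m S -> x \in S -> col e m (S :\ x).
Proof. by case/andP => _ /forall_inP; apply. Qed.

Lemma crit_sub m S (A : {set T}) x : crit e m S -> x \in S -> x \notin A -> A \subset S -> col e m A.
Proof.
move=> cS xS xA AS; apply: sub_col (crit_del cS xS); apply/subsetP => y yA.
rewrite !inE (subsetP AS _ yA) andbT; by apply: contraNneq xA => <-.
Qed.

(** The vertices [g x] lie in the [m]-colourable set [S :\ v], and adjacency makes their colours
    distinct. The clique bounds below use this with [g] a choice of witnesses indexed by [D]. *)
Lemma crit_family_card m S (U : finType) (D : {set U}) (g : U -> T) v :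
  crit e m S -> v \in S -> {in D, forall x, (g x \in S) && (g x != v)} ->
  {in D &, forall x y, x != y -> e (g x) (g y)} -> #|D| <= m.
Proof.
move=> cS vS gS gE; have /colP[f /proper_onP[f1 f2]] := crit_del cS vS.
have gD x : x \in D -> g x \in S :\ v by move/gS/andP => [a b]; rewrite !inE a b.
have fm x : x \in D -> f (g x) < m by move/gD/f1.
case: m cS f1 fm => [|m] cS f1 fm.
  by case: (set_0Vmem D) => [->|[x xD]]; [rewrite cards0 | have := fm _ xD].
pose h x : 'I_m.+1 := inord (f (g x)).
have hinj : {in D &, injective h}.
  move=> x y xD yD /(congr1 (@nat_of_ord _)); rewrite /h !inordK ?fm // => /eqP E.
  apply: contraTeq E => xy; apply: f2; rewrite ?gD //; exact: gE.
rewrite -(card_in_imset hinj) -[X in _ <= X]card_ord; exact: max_card.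
Qed.

(* Otherwise the colour of [y] could be given to [x]. *)
Lemma crit_private_neighbour m S x y :
  crit e m S -> x \in S -> y \in S -> x != y -> ~~ e x y ->
  exists2 z, z \in S & e z x && ~~ e z y.
Proof.
move=> cS xS yS xy nxy; apply/exists_inP; apply: contraT => /exists_inPn h.
case/andP: (cS) => /negP[].
have /colP[f /proper_onP[f1 f2]] := crit_del cS xS.
have yS' : y \in S :\ x by rewrite !inE eq_sym xy.
apply/colP; exists (fun z => if z == x then f y else f z).
apply/proper_onP; split=> [z zS|z t zS tS ezt].
  by case: (eqVneq z x) => [_|zx]; apply: f1; rewrite // !inE zx.
have key w : w \in S -> e w x -> e w y.
  by move=> wS wx; have := h _ wS; rewrite wx /= negbK.
case: (eqVneq z x) => [zx|zx]; case: (eqVneq t x) => [tx|tx].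
- by move: ezt; rewrite zx tx eirr.
- by apply: f2 => //; [rewrite !inE tx | rewrite esym; apply: key; rewrite // esym -zx].
- by apply: f2 => //; [rewrite !inE zx | apply: key; rewrite // -tx].
- by apply: f2; rewrite // !inE ?tx ?zx.
Qed.

(** No edge leaves [R], so if [R] were proper, a colouring of [R] and one of [S] minus a vertex of
    [R] could be glued. *)
Lemma crit_connected m S (R : {set T}) :
  crit e m S -> R \subset S -> R != set0 ->
  {in R, forall x, {in S, forall y, e x y -> y \in R}} -> R = S.
Proof.
move=> cS RS /set0Pn[r rR] cl; apply/eqP; rewrite eqEsubset RS /=.
apply/subsetP => x xS; apply: contraT => xR.
case/andP: (cS) => /negP[].
have /colP[f /proper_onP[f1 f2]] := crit_sub cS xS xR RS.
have /colP[g /proper_onP[g1 g2]] := crit_del cS (subsetP RS _ rR).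
have gR y : y \in S -> y \notin R -> y \in S :\ r.
  by move=> yS yR; rewrite !inE yS andbT; apply: contraNneq yR => ->.
apply/colP; exists (fun z => if z \in R then f z else g z).
apply/proper_onP; split=> [z zS|z t zS tS ezt].
  by case: ifPn => zR; [exact: f1 | apply: g1; exact: gR].
case: ifPn => zR; case: ifPn => tR.
- exact: f2.
- by rewrite (cl _ zR _ tS ezt) in tR.
- by rewrite esym in ezt; rewrite (cl _ tR _ zS ezt) in zR.
- by apply: g2; rewrite ?gR.
Qed.

(** The modules of modular decomposition, also called homogeneous sets. *)
Definition module (S M : {set T}) : bool :=
  [forall z in S :\: M, [forall x in M, e z x] || [forall x in M, ~~ e z x]].

(* A colouring of [S :\ x] restricted to [M :\ x] can be replaced by any
   colouring of [M] that uses at most as many colours. *)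
Lemma crit_module m S (M : {set T}) :
  crit e m S -> M \proper S -> M != set0 -> module S M ->
  exists2 q, q < m & crit e q M.
Proof.
move=> cS /properP[MS [b bS bM]] M0 modM.
have colM : exists q, col e q M by exists m; exact: crit_sub cS bS bM MS.
case: (ex_minnP colM) => q cq minq.
have le_qm : q <= m by apply: minq; exact: crit_sub cS bS bM MS.
have q0 : 0 < q.
  case/colP: cq => f /proper_onP[f1 _]; case/set0Pn: M0 => x xM.
  exact: leq_ltn_trans (f1 _ xM).
exists q.-1; first by rewrite prednK.
apply/andP; split; first by apply/negP => /minq; rewrite leqNgt prednK // leqnn.
apply/forall_inP => x xM; apply: contraT => ncol; case/andP: (cS) => /negP[].
have xS := subsetP MS _ xM.
have /colP[f /proper_onP[f1 f2]] := crit_del cS xS.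
case/colP: cq => g /proper_onP[g1 g2].
pose L := undup [seq f y | y in M :\ x].
have inL y : y \in M :\ x -> f y \in L by move=> yM; rewrite mem_undup image_f.
have inS y : y \in M :\ x -> y \in S :\ x.
  by rewrite !inE => /andP[-> /(subsetP MS)].
have LP c : c \in L -> exists2 y, y \in M :\ x & c = f y.
  by rewrite mem_undup => /imageP[y yM ->]; exists y.
(* With fewer colours in the palette [L], positions in [L] would colour [M :\ x] with [q.-1]
   colours. *)
have sizeL : q <= size L.
  rewrite leqNgt; apply/negP => hL; case/negP: ncol.
  apply: (@leq_col _ _ (size L)); first by rewrite -ltnS prednK.
  apply/colP; exists (fun y => index (f y) L); apply/proper_onP.
  split=> [y yM|y z yM zM eyz]; first by rewrite index_mem inL.
  apply/eqP => /(congr1 (nth 0 L)); rewrite !nth_index ?inL // => E.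
  by move: (f2 _ _ (inS _ yM) (inS _ zM) eyz); rewrite E eqxx.
have gL y : y \in M -> nth 0 L (g y) \in L.
  by move=> /g1 gy; rewrite mem_nth // (leq_trans gy).
have out y : y \in S -> y \notin M -> y \in S :\ x.
  by move=> yS yM; rewrite !inE yS andbT; apply: contraNneq yM => ->.
(* The new colour of [y] is the colour under [f] of some [w] in [M :\ x]; as [z] sees [y],
   modularity makes it see [w]. *)
have cross y z : y \in M -> z \in S -> z \notin M -> e z y -> nth 0 L (g y) != f z.
  move=> yM zS zM ezy; have [w wM ->] := LP _ (gL _ yM).
  apply: f2; [exact: inS | exact: out | rewrite esym].
  have := forall_inP modM z; rewrite inE zM zS => /(_ isT) /orP[] /forall_inP h.
    by apply: h; move: wM; rewrite inE => /andP[].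
  by have := h _ yM; rewrite ezy.
apply/colP; exists (fun y => if y \in M then nth 0 L (g y) else f y).
apply/proper_onP; split=> [y yS|y z yS zS eyz].
  case: ifPn => yM; last by apply: f1; exact: out.
  by have [w wM ->] := LP _ (gL _ yM); apply: f1; exact: inS.
case: ifPn => yM; case: ifPn => zM.
- rewrite nth_uniq ?undup_uniq ?g2 //; first exact: leq_trans (g1 _ yM) _.
  exact: leq_trans (g1 _ zM) _.
- by rewrite cross // esym.
- by rewrite eq_sym cross.
- by apply: f2; rewrite ?out.
Qed.

(** For symmetric irreflexive [e], the listed adjacencies already force the five vertices to be
    distinct. *)
Definition P5_free : Prop := forall a b c d f, e a b -> e b c -> e c d -> e d f ->
  ~~ e a c -> ~~ e a d -> ~~ e a f -> ~~ e b d -> ~~ e b f -> ~~ e c f -> False.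

(** * Neighbourhoods and balls in critical sets *)

Definition neighbours_in S x : {set T} := [set y in S | e x y].

Fixpoint ball S v n : {set T} :=
  if n is n'.+1 then
    ball S v n' :|: \bigcup_(x in ball S v n') neighbours_in S x
  else [set v].

Lemma ball_leq S v n n' : n <= n' -> ball S v n \subset ball S v n'.
Proof.
elim: n' => [|n' IH]; first by rewrite leqn0 => /eqP ->.
by rewrite leq_eqVlt => /orP[/eqP -> //|/IH h]; rewrite (subset_trans h) //= subsetUl.
Qed.

Lemma ball_step S v n x y : x \in ball S v n -> y \in S -> e x y -> y \in ball S v n.+1.
Proof.
move=> xb yS exy; rewrite /= inE; apply/orP; right.
by apply/bigcupP; exists x; rewrite // inE yS.
Qed.

Lemma ball_stepP S v n y : y \in ball S v n.+1 -> y \notin ball S v n ->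
  y \in S /\ exists2 x, x \in ball S v n & e x y.
Proof.
rewrite /= inE => /orP[-> //|/bigcupP[x xb]]; rewrite inE => /andP[yS exy] _.
by split=> //; exists x.
Qed.

Lemma card_ball S v D n : v \in S ->
  {in S, forall x, #|neighbours_in S x| <= D} ->
  ball S v n \subset S /\ #|ball S v n| <= D.+1 ^ n.
Proof.
move=> vS hD; elim: n => [|n [IH1 IH2]] /=.
  by rewrite sub1set vS cards1.
split; first by rewrite subUset IH1; apply/bigcupsP => x _; apply/subsetP => y /[!inE] /andP[].
apply: leq_trans (leq_card_setU _ _).1 _.
rewrite expnS mulSn leq_add // (leq_trans (card_bigcup_leq _ _ _)) //.
rewrite (leq_trans (n := \sum_(i in ball S v n) D)) //.
  by apply: leq_sum => i /(subsetP IH1) /hD.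
by rewrite sum_nat_const mulnC leq_mul2l IH2 orbT.
Qed.

(* A shortest path of length 4 is an induced [P5]. *)
Lemma crit_ball m S v : P5_free -> crit e m S -> v \in S -> ball S v 3 = S.
Proof.
move=> p5 cS vS; apply: (crit_connected cS).
- by have [] := @card_ball S v #|T| 3 vS (fun x _ => max_card _).
- by apply/set0Pn; exists v; apply: (subsetP (@ball_leq S v 0 3 isT)); rewrite inE.
move=> x3 x3b x4 x4S e34; apply: contraT => x4b.
have far n n' x y : n.+1 <= n' -> x \in ball S v n -> y \in S -> y \notin ball S v n' -> ~~ e x y.
  move=> nn' xb yS; apply: contra => exy.
  by apply: (subsetP (ball_leq S v nn')); exact: ball_step exy.
(* Walking back from [x4], no vertex lies in a smaller ball than expected, since its successor would
   then be too close to [v]. *)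
have x3b' : x3 \notin ball S v 2.
  by apply: contraL e34 => h; exact: far h x4S x4b.
have [x3S [x2 x2b e23]] := ball_stepP x3b x3b'.
have x2b' : x2 \notin ball S v 1.
  by apply: contraL e23 => h; exact: far h x3S x3b'.
have [x2S [x1 x1b e12]] := ball_stepP x2b x2b'.
have x1b' : x1 \notin ball S v 0.
  by apply: contraL e12 => h; exact: far h x2S x2b'.
have [x1S [x0 x0b e01]] := ball_stepP x1b x1b'.
by case: (p5 x0 x1 x2 x3 x4) => //;
  [exact: (far 0 1)|exact: (far 0 2)|exact: (far 0 3)|exact: (far 1 2)|exact: (far 1 3)|exact: (far 2 3)].
Qed.

(** A neighbourhood avoids its centre, so it splits into [m] independent classes; degrees are thus
    at most [m * c], and a ball of radius 3 is all of [S]. *)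
Lemma crit_card m S c : P5_free -> crit e m S ->
  (forall v (I : {set T}), v \in S -> I \subset neighbours_in S v ->
     {in I &, forall x y, ~~ e x y} -> #|I| <= c) ->
  #|S| <= (m * c).+1 ^ 3.
Proof.
move=> p5 cS hc; case: (set_0Vmem S) => [->|[v vS]]; first by rewrite cards0.
rewrite -{1}(crit_ball p5 cS vS); apply: (card_ball _ _ _).2 => // x xS.
apply: (@card_col_leq _ e) => [|I IN]; last exact: (hc x).
apply: (crit_sub cS xS); first by rewrite inE eirr andbF.
by apply/subsetP => y /[!inE] /andP[].
Qed.

End Critical.

(** * Chair-free graphs *)

Section Chair.
Variables (T : finType) (e : rel T).
Hypotheses (esym : symmetric e) (eirr : irreflexive e).
Implicit Types (m : nat) (S I : {set T}).

(** The centre is [o], its leaves are [a] and [b], and [o c d] is the long leg. Only the twins [a]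
    and [b] are not told apart by adjacencies. *)
Definition chair_free : Prop := forall o a b c d,
  e o a -> e o b -> e o c -> e c d -> a != b ->
  ~~ e a b -> ~~ e a c -> ~~ e b c -> ~~ e o d -> ~~ e a d -> ~~ e b d -> False.

Hypotheses (p5 : P5_free e) (chair : chair_free).

(** For nonadjacent [u], [u'], incomparable traces give the path [a u c u' b]. Nested distinct
    traces of equal parity differ by two vertices, which are the leaves of a chair centred at [u']
    with long leg [u' c u]. *)
Lemma trace_adjacent I u u' c : {in I &, forall x y, ~~ e x y} ->
  c \in I -> e u c -> e u' c ->
  neighbours_in e I u != neighbours_in e I u' ->
  odd #|neighbours_in e I u| = odd #|neighbours_in e I u'| ->
  e u u'.
Proof.
move=> indI cI; wlog sub : u u' / neighbours_in e I u \subset neighbours_in e I u'.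
  move=> wl uc u'c neq par.
  case: (boolP (neighbours_in e I u \subset neighbours_in e I u')) => [|ns]; first by move=> h; exact: wl.
  case: (boolP (neighbours_in e I u' \subset neighbours_in e I u)) => [h|ns'].
    by rewrite esym; apply: wl; rewrite // eq_sym.
  case/subsetPn: ns => a /[!inE] /andP[aI ua] /[!aI] /= u'a.
  case/subsetPn: ns' => b /[!inE] /andP[bI u'b] /[!bI] /= ub.
  apply: contraT => nuu'; case: (@p5 a u c u' b) => //; first [exact: indI | by rewrite esym].
move=> uc u'c neq par; apply: contraT => nuu'.
have D1 : 1 < #|neighbours_in e I u' :\: neighbours_in e I u|.
  have E := cardsID (neighbours_in e I u) (neighbours_in e I u').
  rewrite (setIidPr sub) in E.
  have : #|neighbours_in e I u' :\: neighbours_in e I u| != 0.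
    by apply: contraNneq neq => /cards0_eq/eqP; rewrite setD_eq0 eqEsubset sub.
  move: par; rewrite -E oddD; case: (#|_ :\: _|) => [|[|n]] //=.
  by case: odd.
case/card_gt1P: D1 => a [b] [] /[!inE] /andP[h1 /andP[aI u'a]] /andP[h2 /andP[bI u'b]] ab.
rewrite aI in h1; rewrite bI in h2.
by case: (@chair u' a b c u) => //; first [exact: indI | by rewrite esym].
Qed.

(** As long as some [u] misses exactly one vertex of [J], delete that vertex and put [u] into [U].
    The members of [U] are complete to what remains and have distinct traces on [I], so those of
    equal parity form a clique; hence there are at most [2 * m] deletions. *)
Lemma exists_chair_gap m S I n0 : crit e m S -> I \subset S ->
  {in I &, forall x y, ~~ e x y} -> 2 < n0 -> n0 + (2 * m).+1 <= #|I| ->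
  exists J : {set T}, [/\ J \subset I, n0 <= #|J|
    & {in S, forall u, #|J :\: neighbours_in e J u| != 1}].
Proof.
move=> cS IS indI n03 hI.
suff key j : j <= (2 * m).+1 ->
   (exists J : {set T}, [/\ J \subset I, n0 <= #|J|
      & {in S, forall u, #|J :\: neighbours_in e J u| != 1}]) \/
   (exists J U : {set T}, [/\ J \subset I, #|I| = #|J| + j, U \subset S /\ #|U| = j,
      {in U & J, forall u x, e u x} & {in U &, injective (neighbours_in e I)}]).
  case: (key _ (leqnn _)) => // -[J] [U] [JI cI [US cU] UJ inj].
  have /card_gt0P[c cJ] : 0 < #|J| by lia.
  have cI' := subsetP JI _ cJ; have cS' := subsetP IS _ cI'.
  have bound b : #|[set u in U | odd #|neighbours_in e I u| == b]| <= m.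
    apply: (crit_family_card (g := id) cS cS').
      move=> u /[!inE] /andP[uU _]; rewrite (subsetP US _ uU) /=.
      by apply: contraTneq (UJ _ _ uU cJ) => ->; rewrite eirr.
    move=> u u' /[!inE] /andP[uU /eqP ou] /andP[u'U /eqP ou'] neq.
    apply: (trace_adjacent indI cI'); rewrite ?UJ ?ou ?ou' //.
    by apply: contra_neq neq; exact: inj.
  have : #|U| <= #|[set u in U | odd #|neighbours_in e I u| == true]| +
                 #|[set u in U | odd #|neighbours_in e I u| == false]|.
    apply: leq_trans (leq_card_setU _ _).1; apply: subset_leq_card.
    by apply/subsetP => u uU; rewrite !inE uU /=; case: odd.
  have := bound true; have := bound false; lia.
elim: j => [|j IH] hj.
  right; exists I, set0; split; rewrite ?addn0 ?sub0set ?cards0 //.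
    by move=> u x; rewrite inE.
  by move=> u x; rewrite inE.
case: (IH (ltnW hj)) => [|[J] [U] [JI cI [US cU] UJ inj]]; first by left.
have hJ : n0 <= #|J| by lia.
case: (boolP [forall u in S, #|J :\: neighbours_in e J u| != 1]) => [/forall_inP good|].
  by left; exists J.
case/forall_inPn => u uS /negPn /cards1P[x Ex].
have /setP/(_ x) := Ex; rewrite !inE eqxx => /andP[ux xJ].
rewrite xJ /= in ux.
have Jx y : y \in J -> y != x -> e u y.
  move=> yJ yx; have /setP/(_ y) := Ex.
  by rewrite !inE yJ (negPf yx) andbT => /negbFE.
have xI := subsetP JI _ xJ.
have uU : u \notin U by apply: contra ux => uU; exact: UJ.
(* Here [x] is still in [J], so every earlier member of [U] sees it while [u] does not. *)
have neqx w : w \in U -> neighbours_in e I u <> neighbours_in e I w.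
  by move=> wU /setP/(_ x); rewrite !inE xI (negPf ux) UJ.
right; exists (J :\ x), (u |: U); split.
- by apply: subset_trans JI; exact: subsetDl.
- by rewrite cI (cardsD1 x J) xJ; lia.
- by rewrite subUset sub1set uS US cardsU1 uU cU.
- move=> w y /[!inE] /orP[/eqP->|wU] /andP[yx yJ]; [exact: Jx | exact: UJ].
move=> w w' /[!inE] /orP[/eqP->|wU] /orP[/eqP->|w'U] //.
- by move=> E; case: (neqx _ w'U).
- by move=> E; case: (neqx _ wU).
- exact: inj.
Qed.

(* With [B] the vertices complete to [J], the vertices outside [B] complete to
   [B] form a module containing [J]. *)
Lemma chair_module m S (J : {set T}) v : crit e m S -> J \subset S ->
  {in J &, forall x y, ~~ e x y} -> 2 < #|J| ->
  {in S, forall u, #|J :\: neighbours_in e J u| != 1} ->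
  v \in S -> {in J, forall x, e v x} ->
  exists M : {set T}, [/\ J \subset M, M \proper S & module e S M].
Proof.
move=> cS JS indJ hJ gap vS vJ.
pose B := [set b in S | [forall x in J, e b x]].
have BP b x : b \in B -> x \in J -> e b x by rewrite inE => /andP[_ /forall_inP]; apply.
have vB : v \in B by rewrite inE vS; apply/forall_inP.
pose M := [set x in S :\: B | [forall b in B, e x b]].
have MP x b : x \in M -> b \in B -> e x b by rewrite inE => /andP[_ /forall_inP]; apply.
have JM : J \subset M.
  apply/subsetP => x xJ; rewrite inE inE (subsetP JS _ xJ) andbT; apply/andP; split.
    by apply/negP => /BP /(_ xJ); rewrite eirr.
  by apply/forall_inP => b bB; rewrite esym BP.
exists M; split=> //.
  apply/properP; split; last by exists v; rewrite // !inE vS (introT forall_inP vJ).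
  by apply/subsetP => x; rewrite !inE => /andP[/andP[_ ->]].
(* Outside [B] at least one vertex of [J] is missed, and by [gap] not exactly one. *)
have miss2 u : u \in S -> u \notin B ->
    exists x y, [/\ x \in J, y \in J, x != y, ~~ e u x & ~~ e u y].
  move=> uS uB.
  have h : 0 < #|J :\: neighbours_in e J u|.
    apply: contraR uB; rewrite -eqn0Ngt => /eqP /cards0_eq /eqP; rewrite setD_eq0 => sub.
    rewrite inE uS; apply/forall_inP => x xJ.
    by have := subsetP sub _ xJ; rewrite inE => /andP[].
  have /card_gt1P : 1 < #|J :\: neighbours_in e J u| by have := gap _ uS; lia.
  case=> x [y] [] /[!inE] /andP[h1 xJ] /andP[h2 yJ] xy.
  by rewrite xJ in h1; rewrite yJ in h2; exists x, y.
apply/forall_inP => z; rewrite in_setD => /andP[zM zS].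
case: (boolP (z \in B)) => zB.
  by apply/orP; left; apply/forall_inP => x xM; rewrite esym MP.
apply/orP; right; apply/forall_inP => y yM; apply/negP => zy.
(* From here [z] is anticomplete, first to [J] and then to [M]: a neighbour of [z] there would be
   the middle of the long leg of a chair centred at [b], with two vertices of [J] as leaves. *)
have {zM} [b bB zb] : exists2 b, b \in B & ~~ e z b.
  apply/exists_inP; rewrite -negb_forall_in; apply: contra zM => h.
  by rewrite inE in_setD zB zS.
have zJ x : x \in J -> ~~ e x z.
  move=> xJ; apply/negP => xz.
  have [a [a' [aJ a'J aa' za za']]] := miss2 z zS zB.
  case: (@chair b a a' x z) => //; first [exact: BP | exact: indJ | by rewrite esym].
have yS : y \in S by move: yM; rewrite !inE => /andP[/andP[]].
have yB : y \notin B by move: yM; rewrite !inE => /andP[/andP[]].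
have [a [a' [aJ a'J aa' ya ya']]] := miss2 y yS yB.
by case: (@chair b a a' y z) => //; first [exact: BP | exact: indJ | exact: zJ | by rewrite esym | by rewrite esym MP].
Qed.

End Chair.

(** Induction on a strict bound for the number of colours: the module found is critical for fewer
    colours, so it has at most [C] vertices, yet it contains [J]. *)
Lemma chair_crit_bounded m : exists C, forall (T : finType) (e : rel T) (S : {set T}) q,
  symmetric e -> irreflexive e -> P5_free e -> chair_free e ->
  q <= m -> crit e q S -> #|S| <= C.
Proof.
suff step n : (exists C, forall (T : finType) (e : rel T) (S : {set T}) q,
    symmetric e -> irreflexive e -> P5_free e -> chair_free e ->
    q < n -> crit e q S -> #|S| <= C) ->
  exists C, forall (T : finType) (e : rel T) (S : {set T}) q,
    symmetric e -> irreflexive e -> P5_free e -> chair_free e ->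
    q < n.+1 -> crit e q S -> #|S| <= C.
  suff: exists C, forall (T : finType) (e : rel T) (S : {set T}) q,
    symmetric e -> irreflexive e -> P5_free e -> chair_free e ->
    q < m.+1 -> crit e q S -> #|S| <= C by [].
  by elim: (m.+1) => [|n IH]; [by exists 0 | exact: step].
(* [C + 3] makes [J] larger than [C] and larger than 2; [(2 * n).+1] pays for the deletions. *)
case=> C hC; exists ((n * (C + 3 + (2 * n).+1)).+1 ^ 3).
move=> T e S q esym eirr p5 ch qn cS.
apply: leq_trans (@crit_card _ e esym eirr q S (C + 3 + (2 * q).+1) p5 cS _) _; last first.
  by rewrite leq_exp2r // ltnS leq_mul //; lia.
move=> v I vS IN indI; rewrite leqNgt; apply/negP => hI.
have IS : I \subset S by apply: subset_trans IN _; apply/subsetP => x /[!inE] /andP[].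
have [||J [JI cJ gap]] := @exists_chair_gap _ e esym eirr p5 ch q S I (C + 3) cS IS indI; try lia.
have indJ : {in J &, forall x y, ~~ e x y}.
  by move=> x y /(subsetP JI) xI /(subsetP JI); exact: indI.
have vJ : {in J, forall x, e v x}.
  by move=> x /(subsetP JI)/(subsetP IN) /[!inE] /andP[].
have J2 : 2 < #|J| by lia.
have [M [JM MS modM]] := chair_module esym eirr ch cS (subset_trans JI IS) indJ J2 gap vS vJ.
have sub := subset_leq_card JM.
have M0 : M != set0 by rewrite -card_gt0; lia.
have [r rq cM] := crit_module esym cS MS M0 modM.
have : #|M| <= C by apply: (hC _ e M r) => //; lia.
lia.
Qed.

(** * Cricket-free graphs *)

Section Cricket.
Variables (T : finType) (e : rel T).
Hypotheses (esym : symmetric e) (eirr : irreflexive e).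
Implicit Types (m : nat) (S I J : {set T}).

Definition cricket_free : Prop := forall o a b c d,
  e o a -> e o b -> e a b -> e o c -> e o d -> c != d -> ~~ e c d ->
  ~~ e a c -> ~~ e a d -> ~~ e b c -> ~~ e b d -> False.

Hypotheses (p5 : P5_free e) (cricket : cricket_free).

(** Otherwise [x a v b y] is an induced path. *)
Lemma incomparable_adjacent I v x y a b : {in I &, forall x y, ~~ e x y} ->
  {in I, forall x, e v x} -> a \in I -> b \in I -> ~~ e v x -> ~~ e v y ->
  e x a -> ~~ e y a -> e y b -> ~~ e x b -> e x y.
Proof.
move=> indI vI aI bI vx vy xa ya yb xb; apply: contraT => xy.
by case: (@p5 x a v b y) => //; first [exact: vI | exact: indI | by rewrite esym | by rewrite esym vI].
Qed.

(** Otherwise the triangle [x y i] with [j] and [j'] pendant at [x] is a cricket. So adjacent [x],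
    [y] whose traces meet differ by at most one vertex on each side. *)
Lemma cricket_miss I x y i j j' : {in I &, forall x y, ~~ e x y} ->
  i \in I -> j \in I -> j' \in I -> e x y -> e x i -> e y i -> e x j -> e x j' ->
  ~~ e y j -> j' != j -> e y j'.
Proof.
move=> indI iI jI j'I xy xi yi xj xj' yj neq; apply: contraT => yj'.
by case: (@cricket x y i j' j) => //; exact: indI.
Qed.

(** [K] collects the vertices [j] missed by a neighbour of [v] that sees something in [I]. By
    [cricket_miss] at [v], such a neighbour misses only [j]; the chosen ones form a clique, so [K]
    is small and can be discarded. *)
Lemma cricket_trim m S I v : crit e m S -> v \in S -> I \subset neighbours_in e S v ->
  {in I &, forall x y, ~~ e x y} -> 2 < #|I| ->
  exists J, [/\ J \subset I, #|I| <= #|J| + m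
    & {in J &, forall i j, i != j ->
        exists x, [/\ x \in S, x != v, ~~ e v x, e x i & ~~ e x j]}].
Proof.
move=> cS vS IN indI I3.
have IS : I \subset S by apply: subset_trans IN _; apply/subsetP => x /[!inE] /andP[].
have vI x : x \in I -> e v x by move/(subsetP IN) => /[!inE] /andP[].
pose P j b := [&& b \in S, e v b, ~~ e b j & [exists i in I, e b i]].
pose K := [set j in I | [exists b, P j b]].
pose g j := odflt v [pick b | P j b].
have gP j : j \in K -> P j (g j).
  rewrite /g !inE => /andP[_ /existsP[b Pb]].
  by case: pickP => [//|/(_ b)]; rewrite Pb.
have only j i : j \in K -> i \in I -> i != j -> e (g j) i.
  move=> jK iI ij; case/and4P: (gP _ jK) => bS vb bj /exists_inP[a aI ba].
  have jI : j \in I by move: jK; rewrite inE => /andP[].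
  by apply: (cricket_miss indI aI jI iI vb _ _ _ _ bj ij) => //; exact: vI.
have KI j : j \in K -> j \in I by rewrite inE => /andP[].
have cK : #|K| <= m.
  apply: (crit_family_card (g := g) cS vS) => [j /gP /and4P[-> vb _ _]|j j' jK j'K jj'] /=.
    by apply: contraTneq vb => ->; rewrite eirr.
  case/and4P: (gP _ jK) => _ _ bj _; case/and4P: (gP _ j'K) => _ _ bj' _.
  (* A third vertex [i] of [I] is the middle of the path [j' (g j) i (g j') j], induced if [g j] and
     [g j'] are nonadjacent. *)
  have /card_gt0P[i] : 0 < #|I :\ j :\ j'|.
    move: I3; rewrite (cardsD1 j I) (cardsD1 j' (I :\ j)) !inE eq_sym jj' !KI //.
  rewrite !inE => /and3P[ij' ij iI]; apply: contraT => nadj.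
  case: (@p5 j' (g j) i (g j') j) => //; try by apply: indI; rewrite // KI.
  - by rewrite esym only ?KI // eq_sym.
  - exact: only.
  - by rewrite esym only.
  - by rewrite only ?KI.
  - by rewrite esym.
exists (I :\: K); split; first exact: subsetDl.
  have := cardsID K I; have := subset_leq_card (subsetIr I K); lia.
move=> i j /setDP[iI iK] /setDP[jI jK] ij.
(* A separator [z] adjacent to [v] would put [j] into [K]. *)
have [z zS /andP[zi zj]] := crit_private_neighbour esym eirr cS (subsetP IS _ iI) (subsetP IS _ jI) ij (indI _ _ iI jI).
exists z; split=> //; first by apply: contraNneq zj => ->; exact: vI.
apply: contra jK => vz; rewrite inE jI; apply/existsP; exists z.
by rewrite /P zS vz zj; apply/exists_inP; exists i.
Qed.

(** The minimal traces cover [J]: [m.+2] counts their sizes from 0 to [m.+1], [m] the traces of each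
    size, [m.+1] the elements of each. The summand 1 covers the case where [J] has no pair to
    separate. *)
Lemma cricket_separated_card m S J v : crit e m S -> v \in S ->
  {in J, forall x, e v x} -> {in J &, forall x y, ~~ e x y} ->
  {in J &, forall i j, i != j ->
        exists x, [/\ x \in S, x != v, ~~ e v x, e x i & ~~ e x j]} ->
  #|J| <= 1 + m.+2 * (m * m.+1).
Proof.
move=> cS vS vJ indJ sep; case: (leqP #|J| 1) => [|J2]; first by lia.
pose X := [set x in S | (x != v) && ~~ e v x].
pose tr := neighbours_in e J.
have XP x : x \in X -> [/\ x \in S, x != v & ~~ e v x] by rewrite inE => /and3P[].
have adj x y a b : x \in X -> y \in X -> a \in tr x -> a \notin tr y ->
    b \in tr y -> b \notin tr x -> e x y.
  move=> /XP[_ _ vx] /XP[_ _ vy]; rewrite !inE => /andP[aJ xa].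
  rewrite aJ => ya /andP[bJ yb]; rewrite bJ => xb.
  exact: (incomparable_adjacent indJ vJ aJ bJ).
have minimal i : i \in J -> exists2 x, (x \in X) && e x i &
    forall y, y \in X -> e y i -> #|tr x| <= #|tr y|.
  move=> iJ; have /card_gt0P[j] : 0 < #|J :\ i| by move: J2; rewrite (cardsD1 i) iJ.
  rewrite !inE => /andP[ji jJ]; rewrite eq_sym in ji.
  have [x0 [x0S x0v vx0 x0i _]] := sep _ _ iJ jJ ji.
  have h0 : (x0 \in X) && e x0 i by rewrite inE x0S x0v vx0.
  case: (@arg_minnP _ x0 (fun x => (x \in X) && e x i) (fun x => #|tr x|) h0) => x hx minx.
  by exists x => // y yX yi; apply: minx; rewrite yX.
(* Each [j] other than [i] in the trace of [x] has a separator [g j] seeing [i] but not [j]; these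
   form a clique, so there are at most [m] such [j]. *)
have small i x : i \in J -> x \in X -> e x i ->
    (forall y, y \in X -> e y i -> #|tr x| <= #|tr y|) -> #|tr x| <= m.+1.
  move=> iJ xX xi minx.
  have itr : i \in tr x by rewrite inE iJ.
  rewrite (cardsD1 i) itr ltnS.
  pose P j y := [&& y \in X, e y i & ~~ e y j].
  pose g j := odflt v [pick y | P j y].
  have trJ j : j \in tr x :\ i -> [/\ j \in J, e x j & j != i].
    by rewrite !inE => /and3P[].
  have gP j : j \in tr x :\ i -> P j (g j).
    case/trJ => jJ xj ji; rewrite eq_sym in ji.
    have [y [yS yv vy yi yj]] := sep _ _ iJ jJ ji.
    rewrite /g; case: pickP => [//|/(_ y)].
    by rewrite /P inE yS yv vy yi yj.
  have only j j' : j \in tr x :\ i -> j' \in tr x :\ i -> j' != j -> e (g j) j'.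
    move=> jD j'D jj'; have [jJ xj ji] := trJ _ jD; have [j'J xj' j'i] := trJ _ j'D.
    have /and3P[yX yi yj] := gP _ jD.
    (* A trace inside [tr x] that misses [j] would be smaller than the minimal one. The traces are
       thus incomparable, which makes [x] and [g j] adjacent. *)
    have [a atr nax] : exists2 a, a \in tr (g j) & a \notin tr x.
      apply/subsetPn; apply/negP => sub; have := minx _ yX yi.
      have : tr (g j) \subset tr x :\ j.
        apply/subsetP => a aT; rewrite in_setD1 (subsetP sub) // andbT.
        by apply: contraTneq aT => ->; rewrite inE (negPf yj) andbF.
      have jtr : j \in tr x by rewrite inE jJ.
      move/subset_leq_card => h1 h2; have := leq_trans h2 h1.
      by rewrite (cardsD1 j (tr x)) jtr ltnn.
    have xy : e x (g j).
      by apply: (adj _ _ j a) => //; rewrite !inE ?jJ ?xj //= (negPf yj).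
    exact: (cricket_miss indJ iJ jJ j'J xy).
  apply: (crit_family_card (g := g) cS vS) => [j /gP /and3P[/XP[-> -> _]]|j j' jD j'D jj'] //.
  have [jJ _ _] := trJ _ jD; have [j'J _ _] := trJ _ j'D.
  have /and3P[yX _ yj] := gP _ jD; have /and3P[y'X _ y'j'] := gP _ j'D.
  apply: (adj _ _ j' j) => //; rewrite !inE ?jJ ?j'J //=.
    by apply: only; rewrite // eq_sym.
  exact: only.
(* Distinct traces of equal size are incomparable, so their representatives form a clique. *)
pose F (s : nat) : {set {set T}} := [set A : {set T} | [exists x in X, (tr x == A) && (#|A| == s)]].
have cF s : #|F s| <= m.
  pose g (A : {set T}) := odflt v [pick x in X | tr x == A].
  have gP (A : {set T}) : A \in F s -> [/\ g A \in X, tr (g A) = A & #|A| = s].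
    rewrite inE => /exists_inP[x xX /andP[/eqP <- /eqP <-]]; rewrite /g.
    by case: pickP => [y /andP[yX /eqP ->]|/(_ x)] //; rewrite xX eqxx.
  apply: (crit_family_card (g := g) cS vS) => [A /gP[/XP[-> ->]]|A A' /gP[gX E sA] /gP[g'X E' sA'] neq] //.
  have /subsetPn[a aA aA'] : ~~ (A \subset A').
    by apply: contra neq => h; rewrite eqEcard h sA sA' leqnn.
  have /subsetPn[b bA' bA] : ~~ (A' \subset A).
    by apply: contra neq => h; rewrite eq_sym eqEcard h sA sA' leqnn.
  by apply: (adj _ _ a b); rewrite ?E ?E'.
have cover : J \subset \bigcup_(s < m.+2) \bigcup_(A in F s) A.
  apply/subsetP => i iJ; have [x /andP[xX xi] minx] := minimal _ iJ.
  have sx : #|tr x| < m.+2 by rewrite ltnS; exact: small minx.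
  apply/bigcupP; exists (Ordinal sx) => //; apply/bigcupP; exists (tr x).
    by rewrite inE; apply/exists_inP; exists x; rewrite // !eqxx.
  by rewrite inE iJ.
apply: leq_trans (subset_leq_card cover) _.
apply: leq_trans (card_bigcup_leq _ _ _) _.
apply: leq_trans (leq_addl 1 _).
rewrite -[m.+2 in X in _ <= X]card_ord -sum_nat_const; apply: leq_sum => s _.
apply: leq_trans (card_bigcup_leq _ _ _) _.
apply: (@leq_trans (\sum_(A in F s) m.+1)).
  apply: leq_sum => A; rewrite inE => /exists_inP[x _ /andP[_ /eqP ->]].
  by rewrite -ltnS.
by rewrite sum_nat_const leq_mul2r cF orbT.
Qed.

Lemma cricket_crit_card m S : crit e m S ->
  #|S| <= (m * (m + 3 + m.+2 * (m * m.+1))).+1 ^ 3.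
Proof.
move=> cS; apply: (crit_card esym eirr p5 cS) => v I vS IN indI.
case: (leqP #|I| 2) => [|I3]; first by lia.
have [J [JI cI sep]] := cricket_trim cS vS IN indI I3.
have indJ : {in J &, forall x y, ~~ e x y}.
  by move=> x y /(subsetP JI) xI /(subsetP JI); exact: indI.
have vJ : {in J, forall x, e v x}.
  by move=> x /(subsetP JI)/(subsetP IN) /[!inE] /andP[].
have := cricket_separated_card cS vS vJ indJ sep; lia.
Qed.

End Cricket.

(** * Transport to induced subgraphs *)

Section Transport.
Variables (T U : finType) (e : rel U) (u : T -> U).
Implicit Types A : {set T}.

Lemma col_imset m A : injective u -> col (relpre u e) m A = col e m (u @: A).
Proof.
move=> u_inj; apply/colP/colP => [[f /proper_onP[f1 f2]]|[f /proper_onP[f1 f2]]].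
  pose g y := if [pick x in A | u x == y] is Some x then f x else 0.
  have gE x : x \in A -> g (u x) = f x.
    move=> xA; rewrite /g; case: pickP => [x' /andP[_ /eqP/u_inj->] //|/(_ x)].
    by rewrite xA eqxx.
  exists g; apply/proper_onP; split=> [_ /imsetP[x xA ->]|].
    by rewrite gE //; exact: f1.
  by move=> _ _ /imsetP[x xA ->] /imsetP[y yA ->] exy; rewrite !gE //; exact: f2.
exists (f \o u); apply/proper_onP; split=> [x xA|x y xA yA exy] /=.
  by apply: f1; exact: imset_f.
by apply: f2; rewrite ?imset_f.
Qed.

Lemma crit_imset m A : injective u -> crit (relpre u e) m A = crit e m (u @: A).
Proof.
move=> u_inj; rewrite /crit col_imset //; congr (_ && _).
have D x : u @: (A :\ x) = (u @: A) :\ u x.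
  apply/setP => y; apply/imsetP/setD1P => [[z /setD1P[zx zA] ->]|[yx /imsetP[z zA E]]].
    by rewrite imset_f // (inj_eq u_inj).
  by exists z => //; rewrite !inE zA -(inj_eq u_inj) -E yx.
apply/forall_inP/forall_inP => [h _ /imsetP[x xA ->]|h x xA].
  by rewrite -D -col_imset // h.
by rewrite col_imset // D h // imset_f.
Qed.

(** Two indices with the same image would be nonadjacent with equal neighbourhoods. Hence tuples
    with repetitions never pass the criticality test. *)
Lemma crit_relpre_inj m : symmetric e -> irreflexive e ->
  crit (relpre u e) m [set: T] -> injective u.
Proof.
move=> esym eirr cT x y uxy; apply/eqP; apply: contraT => xy.
have psym : symmetric (relpre u e) by move=> a b; exact: esym.
have pirr : irreflexive (relpre u e) by move=> a; exact: eirr.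
have nadj : ~~ relpre u e x y by rewrite /= uxy eirr.
have [z _] := crit_private_neighbour psym pirr cT (in_setT x) (in_setT y) xy nadj.
by rewrite /= uxy andbN.
Qed.

End Transport.

(** * Colourability and criticality of induced subgraphs *)

Lemma colourableE m (G : sgraph) : colourable m G = col (@edge G) m [set: G].
Proof.
apply/existsP/colP => [[f /'forall_forallP h]|[f /proper_onP[f1 f2]]].
  exists (fun x => f x : nat); apply/proper_onP; split=> [x _|x y _ _ exy].
    exact: ltn_ord.
  by have /implyP := h x y; apply.
have fm x : f x < m by apply: f1; rewrite inE.
exists [ffun x => Ordinal (fm x)]; apply/'forall_forallP => x y; apply/implyP => exy.
by rewrite !ffunE; apply: f2.
Qed.

Section InducedSubgraphs.
Variable G : sgraph.
Implicit Types S : {set G}.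

Lemma imset_valT S : val @: [set: induced S] = S.
Proof.
apply/setP => x; apply/imsetP/idP => [[y _ ->]|xS]; first exact: valP.
by exists (exist _ x xS).
Qed.

Lemma colourable_induced m S : colourable m (induced S) = col (@edge G) m S.
Proof.
rewrite colourableE -[in RHS](imset_valT S) -col_imset //; exact: val_inj.
Qed.

(** A deleted vertex is put back with the fresh colour [m]. *)
Lemma crit_colS m S : crit (@edge G) m S -> col (@edge G) m.+1 S.
Proof.
move=> cS; case: (set_0Vmem S) => [->|[x xS]].
  by apply/colP; exists (fun=> 0); apply/proper_onP; split=> y; rewrite inE.
have /colP[f /proper_onP[f1 f2]] := crit_del cS xS.
have D y : y \in S -> y != x -> y \in S :\ x by rewrite !inE => -> ->.
apply/colP; exists (fun y => if y == x then m else f y).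
apply/proper_onP; split=> [y yS|y z yS zS eyz].
  by case: (eqVneq y x) => // yx; apply: ltnW; rewrite ltnS f1 ?D.
case: (eqVneq y x) eyz => [->|yx]; case: (eqVneq z x) => [->|zx] eyz.
- by rewrite edge_irrefl in eyz.
- by rewrite neq_ltn f1 ?D ?orbT.
- by rewrite neq_ltn f1 ?D.
- by rewrite f2 ?D.
Qed.

End InducedSubgraphs.

Lemma chromatic_number_leq m (G : sgraph) : (chromatic_number G <= m) = colourable m G.
Proof.
rewrite /chromatic_number; case: ex_minnP => n cn minn.
apply/idP/idP => [le_nm|/minn //].
by move: cn; rewrite !colourableE; exact: leq_col.
Qed.

Lemma vertex_critical_induced m (G : sgraph) (S : {set G}) :
  crit (@edge G) m S -> vertex_critical m.+1 (induced S).
Proof.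
move=> cS; have [nS _] := andP cS; split.
  apply/eqP; rewrite eqn_leq chromatic_number_leq colourable_induced crit_colS //=.
  by rewrite ltnNge chromatic_number_leq colourable_induced.
move=> v; rewrite ltnS chromatic_number_leq colourable_induced.
rewrite -[col _ _ _]/(col (relpre val (@edge G)) m [set~ v]) col_imset; last exact: val_inj.
apply: sub_col (crit_del cS (valP v)); apply/subsetP => _ /imsetP[w wv ->].
by rewrite !inE (valP w) andbT (inj_eq val_inj); move: wv; rewrite !inE.
Qed.

(** * Forbidden patterns given by vertex lists *)

Lemma has_induced_inj (F G : sgraph) (f : F -> G) :
  injective f -> (forall x y, edge (f x) (f y) = edge x y) -> has_induced F G.
Proof.
move=> f_inj fE; pose S := f @: [set: F].
have fS x : f x \in S by rewrite imset_f.
exists S; exists (fun x => exist _ (f x) (fS x)) => //.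
apply: inj_card_bij; first by move=> x y /(congr1 val) /f_inj.
by rewrite card_sig (eq_card (B := mem S)) // card_imset // cardsT.
Qed.

Lemma has_induced_seq n E (G : sgraph) (s : seq G) x0 :
  size s = n -> uniq s ->
  (forall i j : 'I_n, edge (nth x0 s i) (nth x0 s j) = list_edge E i j) ->
  has_induced (graph_of_edges n E) G.
Proof.
move=> size_s uniq_s adj.
apply: (@has_induced_inj (graph_of_edges n E) G (fun i : 'I_n => nth x0 s i)) => //.
move=> i j /eqP; rewrite nth_uniq ?size_s ?ltn_ord // => /eqP.
exact: val_inj.
Qed.

(* Equal vertices would make some adjacency contradict another one. *)
Ltac distinct_vertices :=
  rewrite /= !inE !negb_or !andbT -?andbA; repeat (apply/andP; split) => //;
  apply/eqP => ?; subst;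
  match goal with
  | H : is_true (edge ?x ?x) |- _ => by rewrite edge_irrefl in H
  | H : is_true (edge ?x ?y), H' : is_true (~~ edge ?x ?y) |- _ => by rewrite H in H'
  | H : is_true (edge ?x ?y), H' : is_true (~~ edge ?y ?x) |- _ => by rewrite edge_sym H in H'
  | H : is_true (?x != ?x) |- _ => by rewrite eqxx in H
  end.

Ltac check_adjacency :=
  let i := fresh in let j := fresh in
  move=> i j; case: i => [[|[|[|[|[|i]]]]] lt_i] //;
  case: j => [[|[|[|[|[|j]]]]] lt_j] //=; rewrite /list_edge -val_eqE /= ?edge_irrefl //;
  by [apply/negbTE | rewrite edge_sym | rewrite edge_sym; apply/negbTE].

Section Patterns.
Variable G : sgraph.

Lemma no_P5_free : ~ has_induced P5 G -> P5_free (@edge G).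
Proof.
move=> h a b c d f ab bc cd df ac ad af bd bf cf; apply: h.
apply: (@has_induced_seq 5 _ G [:: a; b; c; d; f] a) => //; first by distinct_vertices.
check_adjacency.
Qed.

Lemma no_chair_free : ~ has_induced chair G -> chair_free (@edge G).
Proof.
move=> h o a b c d oa ob oc cd ab nab ac bc od ad bd; apply: h.
apply: (@has_induced_seq 5 _ G [:: a; o; c; d; b] a) => //; first by distinct_vertices.
check_adjacency.
Qed.

Lemma no_cricket_free : ~ has_induced cricket G -> cricket_free (@edge G).
Proof.
move=> h o a b c d oa ob ab oc od cd ncd ac ad bc bd; apply: h.
apply: (@has_induced_seq 5 _ G [:: o; a; b; c; d] a) => //; first by distinct_vertices.
check_adjacency.
Qed.

End Patterns.

(** * Timed verification of programs *)

(* Quantifying over the continuation [c] makes [wp] compose along [++]. *)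
Definition wp (t : nat) (p : program) (s : state) (Q : state -> Prop) : Prop :=
  exists u s', [/\ u <= t, Q s' & forall c, iter u step (p ++ c, s) = (c, s')].

Lemma wp_nil t s (Q : state -> Prop) : Q s -> wp t [::] s Q.
Proof. by move=> Qs; exists 0, s. Qed.

Lemma wp_weaken t t' p s (Q Q' : state -> Prop) :
  t <= t' -> (forall s', Q s' -> Q' s') -> wp t p s Q -> wp t' p s Q'.
Proof.
move=> tt' QQ' [u [s' [ut Qs' E]]]; exists u, s'; split=> //; last exact: QQ'.
exact: leq_trans tt'.
Qed.

Lemma wp_cat t t' p q s Q :
  wp t p s (fun s' => wp t' q s' Q) -> wp (t + t') (p ++ q) s Q.
Proof.
move=> [u [s1 [ut [u' [s2 [ut' Q2 E2]]] E1]]]; exists (u' + u), s2.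
by split=> [|//|c]; [rewrite addnC leq_add | rewrite iterD -catA E1].
Qed.

Lemma wp_step t i p s s1 (Q : state -> Prop) :
  (forall c, step (i :: c, s) = (c, s1)) -> wp t p s1 Q -> wp t.+1 (i :: p) s Q.
Proof.
move=> E [u [s2 [ut Q2 E2]]]; exists u.+1, s2; split=> // c.
by rewrite iterSr cat_cons E.
Qed.

Lemma wp_const t x a p s (Q : state -> Prop) :
  wp t p (set_reg s x a) Q -> wp t.+1 (Const x a :: p) s Q.
Proof. exact: wp_step. Qed.

Lemma wp_add t x y z p s (Q : state -> Prop) :
  wp t p (set_reg s x (reg s y + reg s z)) Q -> wp t.+1 (Add x y z :: p) s Q.
Proof. exact: wp_step. Qed.

Lemma wp_monus t x y z p s (Q : state -> Prop) :
  wp t p (set_reg s x (reg s y - reg s z)) Q -> wp t.+1 (Monus x y z :: p) s Q.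
Proof. exact: wp_step. Qed.

Lemma wp_fetch t x y p s (Q : state -> Prop) :
  wp t p (set_reg s x (memory s (reg s y))) Q -> wp t.+1 (Fetch x y :: p) s Q.
Proof. exact: wp_step. Qed.

Lemma wp_store t x y p s (Q : state -> Prop) :
  wp t p (set_mem s (reg s x) (reg s y)) Q -> wp t.+1 (Store x y :: p) s Q.
Proof. exact: wp_step. Qed.

Lemma wp_if t x p q s (Q : state -> Prop) :
  wp t (if reg s x != 0 then p else q) s Q -> wp t.+1 [:: If x p q] s Q.
Proof.
move=> [u [s' [ut Qs' E]]]; exists u.+1, s'; split=> // c.
by rewrite iterSr /= E.
Qed.

(** The index of the invariant is the number of rounds left. A round costs its test and the body;
    the final test costs one more step. *)
Lemma wp_while t x p (Inv : nat -> state -> Prop) j s :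
  (forall i s', Inv i s' -> reg s' x = i) ->
  (forall i s', Inv i.+1 s' -> wp t p s' (Inv i)) ->
  Inv j s -> wp (j * t.+1 + 1) [:: While x p] s (Inv 0).
Proof.
move=> cond body; elim: j s => [|j IH] s Inv_s.
  by exists 1, s; split=> // c /=; rewrite (cond _ _ Inv_s).
have [u [s1 [ut Inv1 E1]]] := body _ _ Inv_s.
have [u' [s2 [ut' Inv2 E2]]] := IH _ Inv1.
exists (u' + u).+1, s2; split=> // [|c]; first lia.
by rewrite iterSr /= (cond _ _ Inv_s) /= iterD E1 E2.
Qed.

Lemma wp_halts t p s Q : wp t p s Q -> exists2 s', Q s' & halts_within t p s s'.
Proof.
move=> [u [s' [ut Qs' E]]]; exists s' => //.
have idle k : iter k step ([::], s') = ([::], s') by elim: k => //= k ->.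
by rewrite /halts_within -(subnK ut) iterD -[p]cats0 E idle.
Qed.

(** * The program searching all tuples of bounded length *)

Section Search.

Variables (dec : nat -> seq bool -> bool) (n : nat) (A : nat -> nat).

Definition bits (w : seq nat) : seq bool :=
  [seq A (i * n + j) != 0 | i <- w, j <- w].

Definition hit (w : seq nat) : bool :=
  all (fun x => x < n) w && dec (size w) (bits w).

End Search.

(* Register layout: 0 holds [n], 1 the size of the last hit, 2 the constant 1,
   3 the constant 0, 4 is scratch; the [i]-th vertex of the current tuple,
   its product with [n], its loop counter and the [i]-th vertex of the last hit
   follow in blocks of four. *)
Definition vtx i := 5 + 4 * i.
Definition row i := 6 + 4 * i.
Definition cnt i := 7 + 4 * i.
Definition out i := 8 + 4 * i.

(** A decision tree over all outcomes of the bits: [dec] is evaluated when the program is built,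
    never by the machine. The size of the tree depends on the number of tested pairs only. *)
Fixpoint test_bits (ps : seq (nat * nat)) (leaf : seq bool -> program) : program :=
  if ps is (i, j) :: ps' then
    [:: Add 4 (row i) (vtx j); Fetch 4 4;
        If 4 (test_bits ps' (fun bs => leaf (true :: bs)))
             (test_bits ps' (fun bs => leaf (false :: bs)))]
  else leaf [::].

Definition record m : program :=
  rcons [seq Add (out i) (vtx i) 3 | i <- iota 0 m] (Const 1 m).

Definition leaf (dec : nat -> seq bool -> bool) m bs : program :=
  if dec m bs then record m else [::].

Definition pairs m := [seq (i, j) | i <- iota 0 m, j <- iota 0 m].

(* [d] loops remain to be opened. *)
Fixpoint search dec m d : program :=
  if d is d'.+1 then
    let j := m - d in
    [:: Const (vtx j) 0; Const (row j) 0; Add (cnt j) 0 3;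
        While (cnt j) (search dec m d' ++
          [:: Add (vtx j) (vtx j) 2; Add (row j) (row j) 0; Monus (cnt j) (cnt j) 2])]
  else test_bits (pairs m) (leaf dec m).

(** All [C] addresses are written, whatever the size of the hit. The last instruction answers [1 -
    R[1]], truncated, which is 1 exactly when there was no hit. *)
Definition output_hit C : program :=
  rcons (flatten [seq [:: Const 4 i; Store 4 (out i)] | i <- iota 0 C])
        (Monus 0 2 1).

Definition solver dec C : program :=
  Const 2 1 :: flatten [seq search dec m m | m <- iota 1 C] ++ output_hit C.

(** * Correctness and running time of the search *)

Section Correctness.

Variables (dec : nat -> seq bool -> bool) (C n : nat) (A : nat -> nat).

(** In the absence of multiplication, [row] carries the multiples of [n] needed to address the
    matrix. A nonzero register 1 signals a recorded hit; a later hit may replace it. *)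
Definition inv (w : seq nat) (s : state) : Prop :=
  [/\ memory s = A, [/\ reg s 0 = n, reg s 2 = 1 & reg s 3 = 0],
      forall i, i < size w -> reg s (vtx i) = nth 0 w i /\ reg s (row i) = nth 0 w i * n
    & reg s 1 != 0 ->
      [/\ reg s 1 <= C & hit dec n A (mkseq (fun i => reg s (out i)) (reg s 1))]].

Lemma reg_set s x v y : reg (set_reg s x v) y = if y == x then v else reg s y.
Proof. by []. Qed.

Lemma wp_record m t s (Q : state -> Prop) :
  m < t -> (forall s', memory s' = memory s -> reg s' 1 = m ->
     (forall i, i < m -> reg s' (out i) = reg s (vtx i) + reg s 3) ->
     (forall x, x != 1 -> (forall i, x != out i) -> reg s' x = reg s x) -> Q s') ->
  wp t (record m) s Q.
Proof.
rewrite /record -cats1 => mt hQ.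
apply: (@wp_weaken (m + 1) _ _ _ Q) => //; first by rewrite addn1.
apply: wp_cat.
suff key k s0 : k <= m ->
    memory s0 = memory s ->
    (forall i, i < m - k -> reg s0 (out i) = reg s (vtx i) + reg s 3) ->
    (forall x, (forall i, x != out i) -> reg s0 x = reg s x) ->
   wp k [seq Add (out i) (vtx i) 3 | i <- iota (m - k) k] s0 (wp 1 [:: Const 1 m] ^~ Q).
  by have := @key m s (leqnn _); rewrite subnn; apply.
elim: k s0 => [|k IH] s0 km Ms0 O0 R0 /=.
  apply: wp_nil; apply: wp_const; apply: wp_nil; rewrite subn0 in O0; apply: hQ => //.
  by move=> x x1 xo; rewrite reg_set (negPf x1) R0.
apply: wp_add; have -> : (m - k.+1).+1 = m - k by lia.
apply: IH => //; first lia.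
  move=> i im; rewrite reg_set; case: eqP => [E|ne].
    have -> : i = m - k.+1 by move: E; rewrite /out; lia.
    by rewrite !R0 // => j; rewrite /vtx /out; apply/eqP; lia.
  by apply: O0; move: ne; rewrite /out; lia.
by move=> x xo; rewrite reg_set (negPf (xo _)) R0.
Qed.

Lemma wp_test_bits t ps L s s0 (Q : state -> Prop) :
  memory s0 = memory s -> (forall x, x != 4 -> reg s0 x = reg s x) ->
  (forall s', memory s' = memory s -> (forall x, x != 4 -> reg s' x = reg s x) ->
     wp t (L [seq memory s (reg s (row p.1) + reg s (vtx p.2)) != 0 | p <- ps]) s' Q) ->
  wp (3 * size ps + t) (test_bits ps L) s0 Q.
Proof.
elim: ps L s0 => [|[i j] ps IH] L s0 Ms0 R0 hL; first exact: hL.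
have -> : 3 * size ((i, j) :: ps) + t = (3 * size ps + t).+3 by rewrite /=; lia.
apply: wp_add; apply: wp_fetch; apply: wp_if.
rewrite !reg_set eqxx /= Ms0 !R0 //.
case E: (_ != 0); apply: IH => //.
- by move=> x x4; rewrite !reg_set (negPf x4) R0.
- by move=> s' Ms' Rs'; have := hL _ Ms' Rs'; rewrite /= E.
- by move=> x x4; rewrite !reg_set (negPf x4) R0.
- by move=> s' Ms' Rs'; have := hL _ Ms' Rs'; rewrite /= E.
Qed.

Definition leaf_time m := 3 * (m * m) + m.+1.

(** Loop counters do not occur in [inv], so their preservation is stated apart, for the sake of the
    enclosing loops. *)
Definition searched (w : seq nat) (d : nat) (s s' : state) : Prop :=
  [/\ inv w s', forall i, i < size w -> reg s' (cnt i) = reg s (cnt i),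
    reg s 1 != 0 -> reg s' 1 != 0
    & forall u, size u = d -> hit dec n A (w ++ u) -> reg s' 1 != 0].

Lemma wp_leaf m w s : 0 < m <= C -> size w = m -> all (fun x => x < n) w -> inv w s ->
  wp (leaf_time m) (test_bits (pairs m) (leaf dec m)) s (searched w 0 s).
Proof.
move=> /andP[m0 mC] size_w wn [Ms [R0 R2 R3] Rw R1].
have -> : leaf_time m = 3 * size (pairs m) + m.+1.
  by rewrite /pairs size_allpairs size_iota.
apply: (@wp_test_bits _ _ _ s s) => // s' Ms' Rs'.
have bitsE : [seq memory s (reg s (row p.1) + reg s (vtx p.2)) != 0 | p <- pairs m] = bits n A w.
  rewrite /pairs map_allpairs /bits -(mkseq_nth 0 w) size_w /mkseq.
  rewrite allpairs_mapl allpairs_mapr; apply/eq_in_allpairs => i j /=.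
  rewrite !mem_iota /= add0n -size_w => iw jw.
  by rewrite Ms (Rw _ iw).2 (Rw _ jw).1.
rewrite bitsE /leaf.
have hitE : hit dec n A w = dec m (bits n A w) by rewrite /hit wn size_w.
case: ifP => hw.
  apply: wp_record => // s2 M2 R21 R2out R2x.
  have Rv x : x != 1 -> x != 4 -> (forall i, x != out i) -> reg s2 x = reg s x.
    by move=> x1 x4 xo; rewrite R2x // Rs'.
  split; [|move=> i _|by move=> *; rewrite R21 -lt0n|by move=> *; rewrite R21 -lt0n]; last first.
    by rewrite Rv // => k; rewrite /cnt /out; apply/eqP; lia.
  split=> [||i iw|_].
  - by rewrite M2 Ms'.
  - by rewrite !Rv.
  - rewrite !Rv; first exact: Rw; by [] || (move=> j; rewrite /vtx /row /out; apply/eqP; lia).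
  rewrite R21; split=> //.
  have -> : mkseq (fun i => reg s2 (out i)) m = w; last by rewrite hitE.
  apply: (@eq_from_nth _ 0); rewrite size_mkseq // => i im.
  by rewrite nth_mkseq // R2out // !Rs' // R3 addn0 (Rw i _).1 // size_w.
apply: wp_nil; split; [|by move=> i _; rewrite Rs'|by rewrite Rs'|by move=> u /size0nil ->; rewrite cats0 hitE hw].
  split=> [||i iw|].
  - by rewrite Ms'.
  - by rewrite !Rs'.
  - by rewrite !Rs' //; exact: Rw.
  rewrite Rs' // => /R1[h1 h2]; split=> //.
by rewrite (eq_mkseq (g := fun i => reg s (out i))) // => i; exact: Rs'.
Qed.

Lemma inv_set_reg w s y v : 3 < y ->
  (forall i, i < size w -> y != vtx i /\ y != row i) -> (forall i, y != out i) ->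
  inv w s -> inv w (set_reg s y v).
Proof.
move=> y3 yw yo [Ms [R0 R2 R3] Rw R1].
have R x : x <= 3 -> reg (set_reg s y v) x = reg s x.
  by move=> x3; rewrite reg_set; case: eqP => //; lia.
rewrite /inv !(R 0, R 1, R 2, R 3) //; split=> // [i iw|].
  have [yv yr] := yw _ iw; rewrite !reg_set eq_sym (negPf yv) eq_sym (negPf yr).
  exact: Rw.
rewrite (eq_mkseq (g := fun i => reg s (out i))) // => i.
by rewrite reg_set eq_sym (negPf (yo i)).
Qed.

Lemma inv_rcons w x s : inv (rcons w x) s <->
  [/\ inv w s, reg s (vtx (size w)) = x & reg s (row (size w)) = x * n].
Proof.
split=> [[Ms Rc Rw R1]|[[Ms Rc Rw R1] Rv Rr]].
  have := Rw (size w); rewrite size_rcons ltnS leqnn nth_rcons ltnn eqxx => /(_ isT)[Rv Rr].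
  split=> //; split=> // i iw; have := Rw i; rewrite size_rcons ltnS ltnW //.
  by rewrite nth_rcons iw; apply.
split=> // i; rewrite size_rcons ltnS leq_eqVlt nth_rcons => /orP[/eqP->|iw].
  by rewrite ltnn eqxx.
by rewrite iw; exact: Rw.
Qed.

Fixpoint search_time m d : nat :=
  if d is d'.+1 then n * (search_time m d' + 3).+1 + 4 else leaf_time m.

Lemma wp_search m d w s : 0 < m <= C -> d <= m -> size w = m - d ->
  all (fun x => x < n) w -> inv w s ->
  wp (search_time m d) (search dec m d) s (searched w d s).
Proof.
move=> mC; elim: d w s => [|d IH] w s dm size_w wn inv_s.
  by apply: wp_leaf; rewrite // size_w subn0.
rewrite /search -/search -size_w; set j := size w.
(* The counter [i] runs down while the vertex [n - i] runs up, and all smaller vertices have been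
   tried. At exit the vertex is [n], out of range, which [inv] allows. *)
pose Inv i s' := [/\ i <= n, reg s' (cnt j) = i, inv (rcons w (n - i)) s' &
  [/\ forall k, k < j -> reg s' (cnt k) = reg s (cnt k), reg s 1 != 0 -> reg s' 1 != 0
    & forall x u, x < n - i -> size u = d -> hit dec n A (w ++ x :: u) -> reg s' 1 != 0]].
apply: (@wp_weaken (n * (search_time m d + 3).+1 + 1).+3 _ _ _ (Inv 0)).
- by rewrite /=; lia.
- move=> s' [_ _ /inv_rcons[inv_s' _ _] [hc h1 hu]]; split=> //.
  case=> // x u [size_u] hx; apply: (hu x u) => //.
  move: hx; rewrite /hit all_cat subn0 => /andP[/andP[_ /=]].
  by case/andP.
have fresh k : k < j -> [/\ vtx j != vtx k /\ vtx j != row k, row j != vtx k /\ row j != row k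
    & cnt j != vtx k /\ cnt j != row k].
  by rewrite /vtx /row /cnt => kj; split; split; apply/eqP; lia.
have fresh_out k : [/\ vtx j != out k, row j != out k & cnt j != out k].
  by rewrite /vtx /row /cnt /out; split; apply/eqP; lia.
have upd_inv y v s' : y = vtx j \/ y = row j \/ y = cnt j -> inv w s' -> inv w (set_reg s' y v).
  move=> hy; apply: inv_set_reg; first by case: hy => [|[]] ->; rewrite /vtx /row /cnt; lia.
    by move=> i /fresh[]; case: hy => [|[]] ->.
  by move=> i; have [] := fresh_out i; case: hy => [|[]] ->.
have [vr vc rc] : [/\ vtx j != row j, vtx j != cnt j & row j != cnt j].
  by rewrite /vtx /row /cnt; split; apply/eqP; lia.
have cnt_ne k : k < j -> [/\ cnt k != vtx j, cnt k != row j & cnt k != cnt j].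
  by rewrite /vtx /row /cnt => kj; split; apply/eqP; lia.
have [_ [R0 R2 R3] _ _] := inv_s.
apply: wp_const; apply: wp_const; apply: wp_add.
apply: (@wp_while _ _ _ Inv n); first by move=> i s' [].
- move=> i s' [i_n Rc inv_s' [hc h1 hu]].
  apply: (@wp_cat _ 3).
  apply: (wp_weaken (leqnn _)); last first.
    apply: (IH _ s' (ltnW dm) _ _ inv_s'); first by rewrite size_rcons size_w; lia.
    by rewrite all_rcons wn andbT; lia.
  move=> s2 [inv_s2 hc2 h12 hu2].
  have [inv_w Rv Rr] := (inv_rcons _ _ _).1 inv_s2.
  have [_ [S0 S2 S3] _ _] := inv_w.
  apply: wp_add; apply: wp_add; apply: wp_monus; apply: wp_nil.
  have Rc2 : reg s2 (cnt j) = i.+1 by rewrite hc2 ?size_rcons.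
  split.
  - exact: ltnW.
  - by rewrite !reg_set /= eqxx Rc2 ![cnt j == _]eq_sym (negPf vc) (negPf rc) S2 subn1.
  - apply/inv_rcons; split.
    + by do 3!(apply: (upd_inv); first by auto).
    + rewrite -/j !reg_set (negPf vc) (negPf vr) eqxx Rv S2; lia.
    + rewrite -/j !reg_set (negPf rc) eqxx ![row j == _]eq_sym (negPf vr) Rr /= S0.
      by rewrite -mulSnr; congr (_ * _); lia.
  split.
  - move=> k kj; have [k1 k2 k3] := cnt_ne _ kj.
    by rewrite !reg_set (negPf k1) (negPf k2) (negPf k3) hc2 ?hc // size_rcons ltnW.
  - by move=> /h1 /h12.
  move=> x u; rewrite leq_eqVlt.
  have -> : (x.+1 == n - i) || (x.+1 < n - i) = (x == n - i.+1) || (x < n - i.+1).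
    by apply/idP/idP; lia.
  case/orP=> [/eqP->|xi] size_u hx; last by apply: h12; exact: (hu x u).
  by apply: (hu2 u); rewrite // cat_rcons.
split=> //.
- by rewrite !reg_set eqxx /= R0 R3 addn0.
- rewrite subnn; apply/inv_rcons; split.
  + by do 3!(apply: (upd_inv); first by auto).
  + by rewrite -/j !reg_set (negPf vc) (negPf vr) eqxx.
  + by rewrite -/j !reg_set (negPf rc) eqxx.
split=> [k kj||x u]; last by rewrite subnn.
  by have [k1 k2 k3] := cnt_ne _ kj; rewrite !reg_set (negPf k1) (negPf k2) (negPf k3).
by [].
Qed.

Lemma wp_searches ms s : {subset ms <= iota 1 C} -> inv [::] s ->
  wp (sumn [seq search_time m m | m <- ms]) (flatten [seq search dec m m | m <- ms]) s
     (fun s' => [/\ inv [::] s', reg s 1 != 0 -> reg s' 1 != 0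
        & forall u, size u \in ms -> hit dec n A u -> reg s' 1 != 0]).
Proof.
elim: ms s => [|m ms IH] s sub inv_s; first exact: wp_nil.
have mC : 0 < m <= C by have := sub m; rewrite inE eqxx mem_iota add1n ltnS; apply.
have size0 : size ([::] : seq nat) = m - m by rewrite subnn.
have W := wp_search mC (leqnn m) size0 isT inv_s.
rewrite /=; apply: wp_cat; apply: (wp_weaken (leqnn _) _ W).
move=> s1 [inv_s1 _ mono1 hit1].
have sub' : {subset ms <= iota 1 C} by move=> x xms; apply: sub; rewrite inE xms orbT.
apply: (wp_weaken (leqnn _) _ (IH s1 sub' inv_s1)) => s2 [inv_s2 mono2 hit2].
split=> // [/mono1/mono2 //|u]; rewrite inE => /orP[/eqP size_u|]; last exact: hit2.
by move/(hit1 _ size_u)/mono2.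
Qed.

Lemma wp_output_hit s (Q : state -> Prop) :
  (forall s', (forall i, i < C -> memory s' i = reg s (out i)) ->
     reg s' 0 = reg s 2 - reg s 1 -> reg s' 1 = reg s 1 -> Q s') ->
  wp (2 * C + 1) (output_hit C) s Q.
Proof.
move=> hQ; rewrite /output_hit -cats1; apply: wp_cat.
suff key k s0 : k <= C -> (forall i, i < C - k -> memory s0 i = reg s (out i)) ->
    (forall x, x != 4 -> reg s0 x = reg s x) ->
    wp (2 * k) (flatten [seq [:: Const 4 i; Store 4 (out i)] | i <- iota (C - k) k]) s0
       (wp 1 [:: Monus 0 2 1] ^~ Q).
  by have := key C s (leqnn _); rewrite subnn; apply.
elim: k s0 => [|k IH] s0 kC M0 R0.
  apply: wp_nil; apply: wp_monus; apply: wp_nil; rewrite subn0 in M0; apply: hQ => //.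
    by rewrite reg_set eqxx !R0.
  exact: R0.
rewrite mulnS; apply: wp_const; apply: wp_store; have -> : (C - k.+1).+1 = C - k by lia.
apply: IH; first exact: ltnW.
  move=> i iC; rewrite /= /upd eqxx; case: eqP => [->|ne]; first exact: R0.
  by apply: M0; lia.
by move=> x x4; rewrite /= /upd (negPf x4) R0.
Qed.

Lemma wp_solver :
  wp ((sumn [seq search_time m m | m <- iota 1 C] + (2 * C + 1)).+1) (solver dec C)
     (State (fun x => if x == 0 then n else 0) A)
     (fun s => (reg s 0 = 1 /\ forall w, 0 < size w <= C -> ~~ hit dec n A w) \/
        (reg s 0 = 0 /\ exists w, [/\ 0 < size w <= C, hit dec n A w
                                     & mkseq (memory s) (reg s 1) = w])).
Proof.
apply: wp_const; apply: wp_cat; set s0 := set_reg _ _ _.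
have inv0 : inv [::] s0 by [].
apply: (wp_weaken (leqnn _) _ (wp_searches (fun x => id) inv0)) => s1 [inv1 _ hit1].
apply: wp_output_hit => s2 M2 R20 R21.
have [_ [_ R2 _] _ R1] := inv1; rewrite R2 in R20.
case: (eqVneq (reg s1 1) 0) => [E|ne]; [left|right]; split; try by rewrite R20; lia.
  move=> w size_w; apply/negP => /hit1; rewrite mem_iota add1n ltnS E => /(_ size_w).
  by rewrite eqxx.
have [leC hw] := R1 ne; exists (mkseq (fun i => reg s1 (out i)) (reg s1 1)).
split=> //; first by rewrite size_mkseq lt0n ne.
rewrite R21; apply: (@eq_from_nth _ 0); rewrite !size_mkseq // => i iR.
by rewrite !nth_mkseq // M2 // (leq_trans iR).
Qed.

(** Adding 4 turns the recurrence into [n] times the previous quantity plus 8, and this 8 is at most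
    one more copy of the previous bound. *)
Lemma search_time_leq m d : search_time m d + 4 <= (leaf_time m + 8) * n.+1 ^ d.
Proof.
elim: d => [|d IH]; first by rewrite /=; lia.
have pos : 8 <= (leaf_time m + 8) * n.+1 ^ d.
  by rewrite (leq_trans (leq_addl (leaf_time m) 8)) // leq_pmulr // expn_gt0.
rewrite expnS mulnCA mulSn /=; have -> : (search_time m d + 3).+1 = search_time m d + 4 by lia.
have := leq_mul (leqnn n) IH; lia.
Qed.

End Correctness.

Theorem ram_search (dec : nat -> seq bool -> bool) (C : nat) :
  exists (p : program) (c d : nat), forall (n : nat) (A : nat -> nat),
  exists2 s, halts_within (c * n ^ d + c) p (State (fun x => if x == 0 then n else 0) A) s &
    (reg s 0 = 1 /\ forall w, 0 < size w <= C -> ~~ hit dec n A w) \/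
    (reg s 0 = 0 /\ exists w, [/\ 0 < size w <= C, hit dec n A w
                                 & mkseq (memory s) (reg s 1) = w]).
Proof.
(* One summand for each of the [C] tuple lengths, then the output and the initial instruction. The
   factor [2 ^ C] comes from [n.+1 <= 2 * n] for positive [n]; the additive constant serves
   [n = 0]. *)
pose K := C * (leaf_time C + 8) + (2 * C + 2).
exists (solver dec C), (K * 2 ^ C), C => n A.
suff le_t : (sumn [seq search_time n m m | m <- iota 1 C] + (2 * C + 1)).+1
             <= K * 2 ^ C * n ^ C + K * 2 ^ C.
  have [s Qs hs] := wp_halts (wp_weaken le_t (fun _ => id) (@wp_solver dec C n A)).
  by exists s.
apply: (@leq_trans (K * n.+1 ^ C)).
  rewrite mulnDl -addnS leq_add //; last first.
    by rewrite -addnS leq_pmulr // expn_gt0.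
  rewrite sumnE big_map -mulnA -[X in X * _](size_iota 1 C) -sum1_size big_distrl /=.
  rewrite big_seq [X in _ <= X]big_seq; apply: leq_sum => m.
  rewrite mem_iota add1n ltnS mul1n => /andP[_ mC].
  apply: leq_trans (leq_addr 4 _) _; apply: leq_trans (search_time_leq _ _ _) _.
  rewrite leq_mul ?leq_pexp2l // leq_add2r /leaf_time.
  by have := leq_mul mC mC; lia.
rewrite -!mulnA -mulnDr leq_mul2l; apply/orP; right.
case: n => [|n]; first by rewrite exp1n -ltnS ltnS addn_gt0 expn_gt0 orbT.
apply: leq_trans (leq_addr _ _); rewrite -expnMn.
by case: (C) => [//|c]; rewrite leq_exp2r //; lia.
Qed.

(** * From hits to critical sets *)

Lemma crit_bounded m : exists C, forall F, F = chair \/ F = cricket ->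
  forall G, free2 P5 F G -> forall S : {set G}, crit (@edge G) m S -> #|S| <= C.
Proof.
have [C hC] := chair_crit_bounded m.
exists (C + (m * (m + 3 + m.+2 * (m * m.+1))).+1 ^ 3) => F hF G [p5 nF] S cS.
have esym := @edge_sym G; have eirr := @edge_irrefl G.
case: hF nF => -> nF.
  exact: leq_trans (hC _ _ S m esym eirr (no_P5_free p5) (no_chair_free nF) (leqnn m) cS) (leq_addr _ _).
apply: leq_trans (leq_addl _ _).
exact: (cricket_crit_card esym eirr (no_P5_free p5) (no_cricket_free nF) cS).
Qed.

Lemma nth_allpairs (S T R : Type) (f : S -> T -> R) x0 y0 z0 s t i j :
  i < size s -> j < size t ->
  nth z0 [seq f x y | x <- s, y <- t] (i * size t + j) = f (nth x0 s i) (nth y0 t j).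
Proof.
move=> + jt; elim: s i => [|x s IH] [|i] //= lt_i; rewrite nth_cat size_map.
  by rewrite mul0n jt (nth_map y0).
by rewrite ltnNge mulSn -addnA leq_addr /= addKn IH.
Qed.

Lemma eq_crit (T : finType) (e e' : rel T) m S : e =2 e' -> crit e m S = crit e' m S.
Proof.
move=> ee'; have E A : col e m A = col e' m A.
  apply: eq_existsb => f; apply: eq_forallb => x; congr (_ ==> (_ && _)).
  by apply: eq_forallb => y; rewrite ee'.
by rewrite /crit E; congr (_ && _); apply: eq_forallb => x; rewrite E.
Qed.

Definition bits_crit q m (bs : seq bool) : bool :=
  crit (fun i j : 'I_m => nth false bs (i * m + j)) q [set: 'I_m].

Section HitSets.
Variables (q : nat) (G : sgraph).

Local Notation hitG := (hit (bits_crit q) #|G| (nth 0 (adjacency G))).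

Definition tuple_vertex (x0 : G) (w : seq nat) (i : 'I_(size w)) : G :=
  nth x0 (enum G) (nth 0 w i).

Lemma hitE x0 w : all (fun x => x < #|G|) w ->
  hitG w = crit (relpre (tuple_vertex x0 (w := w)) (@edge G)) q [set: 'I_(size w)].
Proof.
move=> wG; rewrite /hit wG; apply: eq_crit => i j /=.
rewrite (nth_allpairs _ 0 0) ?ltn_ord // {1}cardE (nth_allpairs _ x0 x0) -?cardE.
- by case: edge.
- by apply: (allP wG); rewrite mem_nth.
- by apply: (allP wG); rewrite mem_nth.
Qed.

(** By [crit_relpre_inj] a hit has no repetitions, so it enumerates its set of vertices. *)
Lemma hit_set w : 0 < size w -> hitG w -> exists S : {set G},
  [/\ perm_eq w [seq index x (enum G) | x <- enum S], #|S| = size w & crit (@edge G) q S].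
Proof.
move=> w0 hw; have wG : all (fun x => x < #|G|) w by case/andP: hw.
have /card_gt0P[x0 _] : 0 < #|G|.
  exact: leq_ltn_trans (allP wG _ (mem_nth 0 w0)).
move: hw; rewrite (hitE x0) // => cw.
have u_inj := crit_relpre_inj (@edge_sym G) (@edge_irrefl G) cw.
exists (tuple_vertex x0 (w := w) @: [set: 'I_(size w)]); split.
- have wlt (i : 'I_(size w)) : nth 0 w i < size (enum G).
    by rewrite -cardE; apply: (allP wG); rewrite mem_nth.
  apply: uniq_perm.
  + apply/(uniqP 0) => i j iw jw E.
    have /u_inj /(congr1 val) // :
      tuple_vertex x0 (Ordinal iw) = tuple_vertex x0 (Ordinal jw) by rewrite /tuple_vertex /= E.
  + rewrite map_inj_in_uniq ?enum_uniq // => x y _ _ E.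
    by rewrite -[x](nth_index x0 (mem_enum G x)) E nth_index ?mem_enum.
  move=> a; apply/idP/mapP => [aw|[_ /[!mem_enum] /imsetP[i _ ->] ->]].
    have aw' : index a w < size w by rewrite index_mem.
    exists (tuple_vertex x0 (Ordinal aw')); first by rewrite mem_enum imset_f.
    by rewrite /tuple_vertex index_uniq ?enum_uniq ?(wlt (Ordinal aw')) //= nth_index.
  by rewrite /tuple_vertex index_uniq ?enum_uniq // mem_nth.
- by rewrite card_imset // cardsT card_ord.
- by rewrite -crit_imset.
Qed.

Lemma set_hit (S : {set G}) : S != set0 -> crit (@edge G) q S ->
  hitG [seq index x (enum G) | x <- enum S].
Proof.
move=> /set0Pn[x0 _] cS; set w := map _ _.
have size_w : size w = #|S| by rewrite size_map cardE.
rewrite (hitE x0); last first.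
  by apply/allP => _ /mapP[x _ ->]; rewrite cardE index_mem mem_enum.
have uE i : tuple_vertex x0 (w := w) i = nth x0 (enum S) i.
  have iS : i < size (enum S) by rewrite -cardE -size_w.
  have -> : nth x0 (enum S) i = nth x0 (enum G) (index (nth x0 (enum S) i) (enum G)).
    by rewrite nth_index ?mem_enum.
  by rewrite /tuple_vertex (nth_map x0 0 _ iS).
have ltS (i : 'I_(size w)) : i < size (enum S) by rewrite -cardE -size_w.
have u_inj : injective (tuple_vertex x0 (w := w)).
  move=> i j; rewrite !uE => /eqP; rewrite nth_uniq ?enum_uniq // => /eqP.
  exact: val_inj.
rewrite crit_imset // (_ : _ @: _ = S) //.
apply/eqP; rewrite eqEcard card_imset // cardsT card_ord -size_w leqnn andbT.
by apply/subsetP => _ /imsetP[i _ ->]; rewrite uE -mem_enum mem_nth.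
Qed.

End HitSets.

Theorem mainTheorem3 (k : nat) (hk : 1 <= k) :
  exists C : nat,
  forall F : sgraph, F = chair \/ F = cricket ->
  exists (p : program) (c d : nat),
  forall G : sgraph, free2 P5 F G ->
  exists s : state,
    [/\ halts_within (c * #|G| ^ d + c) p (input G) s,
        answers s (colourable (k - 1) G)
      & ~~ colourable (k - 1) G ->
        exists S : {set G},
          [/\ outputs s S, #|S| <= C & vertex_critical k (induced S)]].
Proof.
have [C hC] := crit_bounded (k - 1).
have [p [c [d hp]]] := ram_search (bits_crit (k - 1)) C.
exists C => F hF; exists p, c, d => G freeG.
have [s hs res] := hp #|G| (nth 0 (adjacency G)).
exists s; rewrite /answers; case: res => [[R0 nohit]|[R0 [w [sw hw Mw]]]].
  (* Otherwise [G] contains a critical set; it is nonempty, as the empty set is colourable, and has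
     at most [C] vertices, so its enumeration would have been a hit. *)
  have colG : colourable (k - 1) G.
    rewrite colourableE; apply: contraT => /crit_exists[S _ cS].
    have S0 : S != set0.
      apply/eqP => S0; case/andP: cS => /negP[]; rewrite S0; apply/colP; exists (fun=> 0).
      by apply/proper_onP; split=> x; rewrite inE.
    have sizeS : 0 < size [seq index x (enum G) | x <- enum S] <= C.
      by rewrite size_map -cardE card_gt0 S0 (hC F hF G freeG).
    by move: (nohit _ sizeS); rewrite set_hit.
  by rewrite colG R0.
have /andP[w0 wC] := sw.
(* The recorded hit is the certificate and also proves the negative answer correct. *)
have [S [permS cardS cS]] := hit_set w0 hw.
have ncol : ~~ colourable (k - 1) G.
  rewrite colourableE; case/andP: cS => nS _; apply: contra nS.
  exact/sub_col/subsetT.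
rewrite (negPf ncol) R0; split=> // _; exists S; split.
- by rewrite /outputs Mw.
- by rewrite cardS.
- by rewrite -[k](subnK hk) addn1; exact: vertex_critical_induced.
Qed.
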